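(* Let $M$ be a subset of a normed linear space $X$, let $f\in X$, and suppose $f$ has a unique best approximant from $M$, denoted $P_M(f)$. Assume that for some $\gamma>0$ $$\|f-m\|-\|f-P_M(f)\|\ge\gamma\,\|m-P_M(f)\|$$ for all $m\in M$. Then for each $g\in X$ and any best approximant $P_M(g)$ to $g$ from $M$, $$\|P_M(f)-P_M(g)\|\le\frac{2}{\gamma}\,\|f-g\|.$$
   Context: A best approximant to $g\in X$ from $M$ is an element $m_0\in M$ with $\|g-m_0\|\le\|g-m\|$ for all $m\in M$; $P_M(g)$ denotes any such element (when one exists). *)

(* Defs.v *)
From mathcomp Require Import all_boot all_order all_algebra.
From mathcomp Require Import classical_sets reals topology normedtype.
Set Implicit Arguments.
Unset Strict Implicit.
Unset Printing Implicit Defensive.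
Import Order.TTheory GRing.Theory Num.Theory.
Import numFieldNormedType.Exports.
Local Open Scope ring_scope.

(* [K] may be the real or the complex field; norms are [K]-valued. *)
Definition best_approximant (K : numFieldType) (X : normedModType K)
    (M : set X) (g m0 : X) : Prop :=
  M m0 /\ forall m, M m -> `|g - m0| <= `|g - m|.

(* Main.v *)
Require Import Defs.
From mathcomp Require Import all_boot all_order all_algebra.
From mathcomp Require Import classical_sets reals topology normedtype.
Set Implicit Arguments.
Unset Strict Implicit.
Unset Printing Implicit Defensive.
Import Order.TTheory GRing.Theory Num.Theory.
Import numFieldNormedType.Exports.
Local Open Scope ring_scope.

(** Strong unicity at [m = PMg] reduces the bound to showing that [PMg] is nearly as good for [f] as
    [PMf]: its error exceeds the optimal one by at most twice the distance from [f] to [g]. *)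

Theorem theorem3p1 (K : numFieldType) (X : normedModType K) (M : set X)
    (f PMf : X) (PMfP : unique (best_approximant M f) PMf)
    (gamma : K) (gamma_gt0 : 0 < gamma)
    (strong_unicity : forall m : X, M m ->
      `|f - m| - `|f - PMf| >= gamma * `|m - PMf|) :
  forall g PMg : X, best_approximant M g PMg ->
    `|PMf - PMg| <= 2 / gamma * `|f - g|.
Proof.
case: PMfP => -[MPMf _] _ g PMg [MPMg PMg_best].
rewrite mulrAC ler_pdivlMr // mulrC distrC.
apply: le_trans (strong_unicity _ MPMg) _.
(* Passing from [f] to [g] costs the first copy of the distance. *)
rewrite lerBlDr; apply: le_trans (ler_distD g _ _) _.
rewrite mulr_natl mulr2n -addrA lerD2l.
(* Optimality of [PMg] for [g] allows replacing it by [PMf]; returning from [g] to [f] costs the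
   second copy. *)
by apply: le_trans (PMg_best _ MPMf) _; rewrite (distrC f g) ler_distD.
Qed.
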